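(* Let $P$ be the class of all finite Heyting algebras that are projective in the variety of all Heyting algebras. Then $(P;\leq)$ is well quasi-ordered, where $\mathbf{A}\leq\mathbf{B}$ means that $\mathbf{A}$ is isomorphic to a subalgebra of $\mathbf{B}$.
   Context: Heyting algebras are algebras $(A;\land,\lor,\to,\neg)$ with $(A;\land,\lor)$ a bounded distributive lattice, $\to$ the relative pseudocomplement and $\neg x=x\to\mathbf{0}$. An algebra $\mathbf{C}$ of a variety $\mathsf{V}$ is projective in $\mathsf{V}$ if for all $\mathbf{A}_1,\mathbf{A}_2\in\mathsf{V}$, every surjective homomorphism $h:\mathbf{A}_1\to\mathbf{A}_2$ and every homomorphism $f:\mathbf{C}\to\mathbf{A}_2$ there is a homomorphism $g:\mathbf{C}\to\mathbf{A}_1$ with $hg=f$. A quasi-ordered set is well quasi-ordered if every strictly decreasing sequence is finite and it contains no infinite antichain (set of pairwise incomparable elements). *)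

(* Defs.v *)
From HB Require Import structures.
From mathcomp Require Import all_boot all_order.
From mathcomp Require Import boolp classical_sets functions cardinality.

Set Implicit Arguments.
Unset Strict Implicit.
Unset Printing Implicit Defensive.

Import Order.Theory.
Local Open Scope classical_set_scope.
Local Open Scope order_scope.

HB.mixin Record TBDistrLattice_isHeyting d T of Order.TBDistrLattice d T := {
  himp : T -> T -> T;
  le_himp : forall x y z : T, (z <= himp x y) = (Order.meet z x <= y)
}.

(* The display d only drives notations, and classically every type carries the
   eqType and choiceType structures that come with an order, so neither
   restricts the variety. The trivial algebra, in which 0 = 1, is included. *)
#[short(type="heytingType")]
HB.structure Definition Heyting d :=
  {T of TBDistrLattice_isHeyting d T & Order.TBDistrLattice d T}.

Definition hneg d (A : heytingType d) (x : A) : A := himp x \bot.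

(* The signature is (/\, \/, ->, ~), as for subalgebras below. The bounds are
   preserved as well, since 1 = (x -> x) and 0 = ~ 1. *)
Definition heyting_morphism d (A B : heytingType d) (f : A -> B) : Prop :=
  [/\ {morph f : x y / Order.meet x y},
      {morph f : x y / Order.join x y},
      {morph f : x y / himp x y}
    & {morph f : x / hneg x}].

Definition heyting_subalgebra d (B : heytingType d) (S : set B) : Prop :=
  S !=set0 /\
  [/\ forall x y, S x -> S y -> S (Order.meet x y),
      forall x y, S x -> S y -> S (Order.join x y),
      forall x y, S x -> S y -> S (himp x y)
    & forall x, S x -> S (hneg x)].

(* The operations of a subalgebra S of B are those of B restricted to S, so an
   isomorphism from A to S is a morphism A -> B that is a bijection onto S. *)
Definition heyting_embeds d (A B : heytingType d) : Prop :=
  exists S : set B, heyting_subalgebra S /\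
    exists f : A -> B, heyting_morphism f /\ set_bij [set: A] S f.

Definition heyting_projective d (C : heytingType d) : Prop :=
  forall (A1 A2 : heytingType d) (h : A1 -> A2) (f : C -> A2),
    heyting_morphism h -> set_surj [set: A1] [set: A2] h ->
    heyting_morphism f ->
    exists g : C -> A1, heyting_morphism g /\ h \o g = f.

Definition finite_projective_heyting d : set (heytingType d) :=
  [set A : heytingType d | finite_set [set: A] /\ heyting_projective A].

Arguments finite_projective_heyting d : clear implicits.

Section WellQuasiOrder.
Context {T : Type} (P : set T) (le : T -> T -> Prop).

Definition quasi_ordered : Prop :=
  (forall x, P x -> le x x) /\
  (forall x y z, P x -> P y -> P z -> le x y -> le y z -> le x z).

Definition strictly_decreasing (s : nat -> T) : Prop :=
  forall n, le (s n.+1) (s n) /\ ~ le (s n) (s n.+1).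

Definition antichain (S : set T) : Prop :=
  forall x y, S x -> S y -> x <> y -> ~ le x y /\ ~ le y x.

Definition well_quasi_ordered : Prop :=
  [/\ quasi_ordered,
      ~ (exists s : nat -> T, (forall n, P (s n)) /\ strictly_decreasing s)
    & ~ (exists S : set T, [/\ S `<=` P, infinite_set S & antichain S])].

End WellQuasiOrder.

(* Main.v *)
(** Retracting a cover of A in which a single point has been added to the dual
    poset shows that, when A is finite projective, the join u of two
    incomparable elements is the greatest element strictly below some j.
    Iterating this produces an infinite ascending chain unless u is comparable
    with every element, so A is a stack of two-element chains and four-element
    Boolean algebras, each glued on top of the preceding one; it is coded by the
    sequence of the numbers of consecutive Boolean blocks between successive
    two-element ones.  A two-element block may be sent to any nonempty stretch
    of blocks, hence A embeds in B as soon as the first entry of the code of A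
    is at most that of B and the rest of the code of A embeds in that of B in
    the sense of Higman; Higman's lemma then concludes. *)

From HB Require Import structures.
Require Import Defs.
From mathcomp Require Import all_boot all_order.
From mathcomp Require Import boolp classical_sets functions cardinality.

Set Implicit Arguments.
Unset Strict Implicit.
Unset Printing Implicit Defensive.

Import Order.Theory.
Local Open Scope order_scope.

(** * Adding a point to the dual poset *)

Section PointExtension.
Context {d : Order.disp_t} (A : heytingType d) (u : A).

(* If X is the dual poset of A, and u is viewed as an up-set of X, this is the
   algebra of up-sets of X with one more point, strictly below exactly the
   points of u; the boolean tells whether that point is in the up-set. *)
Definition point_ext := {x : A * bool | x.2 ==> (u <= x.1)}.
HB.instance Definition _ := Choice.on point_ext.

Implicit Types x y z : point_ext.

Lemma point_ext_eq x y :
  (val x).1 = (val y).1 -> (val x).2 = (val y).2 -> x = y.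
Proof.
move=> e1 e2; apply/val_inj.
by rewrite [val x]surjective_pairing [val y]surjective_pairing e1 e2.
Qed.

Lemma point_ext_eqE x y :
  (x == y) = ((val x).1 == (val y).1) && ((val x).2 == (val y).2).
Proof. by rewrite -val_eqE -pair_eqE. Qed.

Definition pe_le x y := ((val x).1 <= (val y).1) && ((val x).2 ==> (val y).2).

Lemma pe_meet_subproof x y :
  ((val x).2 && (val y).2) ==> (u <= Order.meet (val x).1 (val y).1).
Proof.
case: x y => [[a e] /= p] [[b f] /= q]; apply/implyP => /andP[he hf].
by rewrite lexI (implyP p he) (implyP q hf).
Qed.
Definition pe_meet x y : point_ext :=
  exist _ (Order.meet (val x).1 (val y).1, (val x).2 && (val y).2)
    (pe_meet_subproof x y).

Lemma pe_join_subproof x y :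
  ((val x).2 || (val y).2) ==> (u <= Order.join (val x).1 (val y).1).
Proof.
case: x y => [[a e] /= p] [[b f] /= q]; apply/implyP => /orP[he|hf].
- by rewrite (le_trans (implyP p he)) ?leUl.
- by rewrite (le_trans (implyP q hf)) ?leUr.
Qed.
Definition pe_join x y : point_ext :=
  exist _ (Order.join (val x).1 (val y).1, (val x).2 || (val y).2)
    (pe_join_subproof x y).

Lemma pe_himp_subproof x y :
  (((val x).2 ==> (val y).2) && (u <= himp (val x).1 (val y).1))
    ==> (u <= himp (val x).1 (val y).1).
Proof. by apply/implyP => /andP[]. Qed.
(** The new point lies in an implication when it satisfies it itself and all points strictly above
    it, which are those of [u], lie in the implication too. *)
Definition pe_himp x y : point_ext :=
  exist _ (himp (val x).1 (val y).1,
    ((val x).2 ==> (val y).2) && (u <= himp (val x).1 (val y).1))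
    (pe_himp_subproof x y).

Definition pe_bot : point_ext := exist _ (\bot, false) isT.
Definition pe_top : point_ext := exist _ (\top, true) (lex1 u).

Lemma pe_le_def x y : pe_le x y = (pe_meet x y == x).
Proof.
rewrite point_ext_eqE /pe_le /= eq_meetl.
by case: (val x).2 (val y).2 => [] [].
Qed.
Lemma pe_meetC : commutative pe_meet.
Proof. by move=> x y; apply: point_ext_eq; rewrite /= (meetC, andbC). Qed.
Lemma pe_joinC : commutative pe_join.
Proof. by move=> x y; apply: point_ext_eq; rewrite /= (joinC, orbC). Qed.
Lemma pe_meetA : associative pe_meet.
Proof. by move=> x y z; apply: point_ext_eq; rewrite /= (meetA, andbA). Qed.
Lemma pe_joinA : associative pe_join.
Proof. by move=> x y z; apply: point_ext_eq; rewrite /= (joinA, orbA). Qed.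
Lemma pe_joinKI y x : pe_meet x (pe_join x y) = x.
Proof. by apply: point_ext_eq; rewrite /= ?joinKI // orbC orKb. Qed.
Lemma pe_meetKU y x : pe_join x (pe_meet x y) = x.
Proof. by apply: point_ext_eq; rewrite /= ?meetKU // andbC andKb. Qed.
Lemma pe_meetUl : left_distributive pe_meet pe_join.
Proof. by move=> x y z; apply: point_ext_eq; rewrite /= (meetUl, andb_orl). Qed.
Lemma pe_meetxx : idempotent_op pe_meet.
Proof. by move=> x; apply: point_ext_eq; rewrite /= (meetxx, andbb). Qed.

HB.instance Definition _ := Order.isMeetJoinDistrLattice.Build d point_ext
  pe_le_def (fun _ _ => erefl) pe_meetC pe_joinC pe_meetA pe_joinA
  pe_joinKI pe_meetKU pe_meetUl pe_meetxx.

Lemma pe_le0x x : (pe_bot : point_ext) <= x.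
Proof. by rewrite /Order.le /= /pe_le /= le0x. Qed.
Lemma pe_lex1 x : x <= (pe_top : point_ext).
Proof. by rewrite /Order.le /= /pe_le /= lex1 implybT. Qed.
HB.instance Definition _ := Order.hasBottom.Build d point_ext pe_le0x.
HB.instance Definition _ := Order.hasTop.Build d point_ext pe_lex1.

Lemma pe_le_himp x y z : (z <= pe_himp x y) = (Order.meet z x <= y).
Proof.
rewrite /Order.le /= /pe_le /= le_himp.
case: x y z => [[a e] /= p] [[b f] /= q] [[c g] /= r].
(* If the new point is in [z], then [u <= c], so the extra condition on [u] follows from
   [c <= himp a b]. *)
have [h|//] := boolP (_ <= b); case: g r => //= r.
by rewrite (le_trans r) ?le_himp // andbT.
Qed.
HB.instance Definition _ :=
  TBDistrLattice_isHeyting.Build d point_ext pe_le_himp.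

End PointExtension.

(** * Bounds, implications and morphisms *)

Section HeytingFacts.
Context {d : Order.disp_t} {A : heytingType d}.
Implicit Types a b c x y z : A.

Lemma himp_le1 x y : x <= y -> himp x y = \top.
Proof. by move=> xy; apply/eqP; rewrite -le1x le_himp meet1x. Qed.

End HeytingFacts.

Lemma morphism_top d (A B : heytingType d) (f : A -> B) :
  heyting_morphism f -> f \top = \top.
Proof.
by case=> _ _ fI _; rewrite -(himp_le1 (lexx (\top : A))) fI himp_le1.
Qed.

Lemma morphism_bot d (A B : heytingType d) (f : A -> B) :
  heyting_morphism f -> f \bot = \bot.
Proof.
have neg1 (C : heytingType d) : hneg (\top : C) = \bot.
  by apply/eqP; rewrite -lex0 -[hneg _]meetx1 -le_himp.
by move=> fM; case: (fM) => _ _ _ fN; rewrite -neg1 fN (morphism_top fM) neg1.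
Qed.

(** * What projectivity forces on a finite algebra *)

Section Projective.
Context {d : Order.disp_t} {A : heytingType d}.
Hypothesis finA : exists s : seq A, forall x, x \in s.
Hypothesis projA : heyting_projective A.

(** Forgetting the new point is a surjective morphism onto [A], so projectivity splits it, and [e]
    is the boolean component of the splitting. Dually, the extended poset retracts onto the original
    one and [e] describes the image of the new point. *)
Lemma projective_point (u : A) :
  exists e : A -> bool,
  [/\ forall x, e x -> u <= x,
      {morph e : x y / Order.meet x y >-> x && y},
      {morph e : x y / Order.join x y >-> x || y},
      forall x y, e (himp x y) = (e x ==> e y) && (u <= himp x y)
    & e \top /\ ~~ e \bot].
Proof.
pose h (x : point_ext u) : A := (val x).1.
have hM : heyting_morphism h by [].
have hS : set_surj [set: point_ext u] [set: A] h.
  by move=> x _; exists (exist _ (x, false) isT).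
have idM : heyting_morphism (id : A -> A) by [].
have [g [gM hg]] := projA hM hS idM.
have g1 x : (val (g x)).1 = x by have := congr1 (fun k => k x) hg.
exists (fun x => (val (g x)).2); split.
- by move=> x; have := valP (g x); rewrite g1 => /implyP.
- by case: gM => gI _ _ _ x y; rewrite gI.
- by case: gM => _ gU _ _ x y; rewrite gU.
- by case: gM => _ _ gI _ x y; rewrite gI /= !g1.
- by rewrite (morphism_top gM) (morphism_bot gM).
Qed.

(** The prime filter that [projective_point] attaches to the join [u] consists of elements above
    [u]; by finiteness it has a least element, which is the required [j]. *)
Lemma projective_cover (a b : A) : ~~ (a <= b) -> ~~ (b <= a) ->
  exists2 j : A, Order.join a b < j &
    forall x, x < j -> x <= Order.join a b.
Proof.
move=> nab nba; set u := Order.join a b.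
have [e [eu eI eU eH [e1 _]]] := projective_point u.
have [s sA] := finA.
(* [e] is the indicator of a prime filter, and [j] generates it. *)
pose j := \meet_(x <- s | e x) x.
have ej : e j.
  by apply: (big_ind e) => // x y ex ey; rewrite eI ex.
have jmin x : e x -> j <= x by move=> ex; apply: meets_inf_seq.
exists j.
  (* If [j] were [u], primeness would put [a] or [b] in the filter, hence above [u], making them
     comparable. *)
  rewrite lt_neqAle (eu _ ej) andbT; apply: contraNneq nba => uj.
  move: ej; rewrite -uj eU => /orP[] /eu; rewrite leUx lexx ?andbT //= => h.
  by rewrite h in nab.
move=> x xj; have nex : ~~ e x.
  by apply/negP => /jmin /(lt_le_trans xj); rewrite ltxx.
(* As [x] is outside the filter and [u <= himp x u], this implication is inside it, hence above
   [j]. *)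
have : e (himp x u) by rewrite eH (negbTE nex) /= le_himp leIl.
by move=> /jmin; rewrite le_himp; have /meet_idPr -> := ltW xj.
Qed.

End Projective.

(** * Higman's lemma and embeddings between codes *)

Section Higman.
Local Open Scope nat_scope.

Inductive higman : seq nat -> seq nat -> Prop :=
| higman_nil v : higman [::] v
| higman_drop b u v : higman u v -> higman u (b :: v)
| higman_cons a b u v : a <= b -> higman u v -> higman (a :: u) (b :: v).

Lemma nat_argmin (T : Type) (P : T -> Prop) (m : T -> nat) :
  (exists x, P x) -> exists2 x, P x & forall y, P y -> m x <= m y.
Proof.
move=> [x Px]; move: {2}(m x) (leqnn (m x)) => n.
elim: n x Px => [|n IHn] x Px mx.
  by exists x => // y _; move: mx; rewrite leqn0 => /eqP ->.
have [[y [Py yx]]|nex] := pselect (exists y, P y /\ m y < m x).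
  by apply: (IHn y) => //; rewrite -ltnS (leq_trans yx).
exists x => // y Py; rewrite leqNgt; apply/negP => yx.
by apply: nex; exists y.
Qed.

(** Each index is chosen to minimise [a] over the tail that follows the previous index; all later
    indices lie in that tail. *)
Lemma nat_monotone_subsequence (a : nat -> nat) :
  exists f : nat -> nat, [/\ {homo f : i j / i < j}
    & forall i j, i <= j -> a (f i) <= a (f j)].
Proof.
have argmin n : {k | n <= k & forall i, n <= i -> a k <= a i}.
  by apply: cid2; apply: (@nat_argmin nat (leq n) a); exists n.
pose next n := s2val (argmin n).
have next_ge n : n <= next n by apply: (s2valP (argmin n)).
have next_min n i : n <= i -> a (next n) <= a i.
  exact: (s2valP' (argmin n)).
pose f := fix f n := if n is m.+1 then next (f m).+1 else next 0.
have fS n : f n < f n.+1 by apply: next_ge.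
have f_mono : {homo f : i j / i < j} by apply: homo_ltn => //; apply: ltn_trans.
have f_le : {homo f : i j / i <= j}.
  by move=> i j; rewrite leq_eqVlt => /predU1P[->//|/f_mono/ltnW].
exists f; split=> // i j ij.
have := f_le _ _ ij; case: i {ij} => [|i] h; first exact: next_min.
by apply: next_min; apply: leq_trans (next_ge _) h.
Qed.

Definition bad_sequence (s : nat -> seq nat) :=
  forall i j, i < j -> ~ higman (s i) (s j).

(* Nash-Williams: the n-th term is chosen of minimal size among all bad
   sequences that agree with the terms already chosen. *)
Lemma minimal_bad_sequence (s : nat -> seq nat) : bad_sequence s ->
  exists m, bad_sequence m /\
    forall n t, bad_sequence t -> (forall i, i < n -> t i = m i) ->
      size (m n) <= size (t n).
Proof.
move=> s_bad.
pose agree n (t t' : nat -> seq nat) := forall i, i < n -> t i = t' i.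
(* Badness is a premise inside the specification so that [S] is a plain recursion; the default for a
   [t] that is not bad is [t] itself. *)
have step n t : {t' | bad_sequence t ->
    [/\ bad_sequence t', agree n t' t &
        forall t'', bad_sequence t'' -> agree n t'' t ->
          size (t' n) <= size (t'' n)]}.
  apply: cid; have [t_bad|] := pselect (bad_sequence t); last by exists t.
  have [|t' [t'_bad t't] t'min] := @nat_argmin _
    (fun t' => bad_sequence t' /\ agree n t' t) (fun t' => size (t' n)).
    by exists t.
  by exists t' => _; split=> // t'' b ag; apply: t'min.
pose S := fix S n := if n is k.+1 then sval (step k (S k)) else s.
have S_bad n : bad_sequence (S n).
  by elim: n => //= n /(svalP (step n (S n)))[].
have S_step n := svalP (step n (S n)) (S_bad n).
have S_agree k n i : i < n -> S (n + k) i = S n i.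
  move=> i_n; elim: k => [|k IHk]; first by rewrite addn0.
  rewrite addnS -IHk /=; have [_ ag _] := S_step (n + k).
  by rewrite ag // ltn_addr.
(* Diagonal: [S n.+1] is the stage at which the n-th term is minimised, and later stages keep it. *)
pose m n := S n.+1 n.
have Sm n i : i < n -> S n i = m i.
  by move=> i_n; rewrite /m -(subnKC i_n) S_agree.
exists m; split.
  move=> i j ij; rewrite -(Sm j.+1 i) ?(ltnW ij) ?ltnS; last exact: ltnW.
  exact: S_bad.
move=> n t t_bad t_m; have [_ _ mn] := S_step n; apply: mn => // i i_n.
by rewrite t_m // Sm.
Qed.

(** The terms of a minimal bad sequence are nonempty. Keeping the terms before [f 0] and continuing
    with the tails of a subsequence with nondecreasing heads gives a bad sequence with a shorter
    term at [f 0], against minimality. *)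
Lemma higman_good (s : nat -> seq nat) :
  exists i j, i < j /\ higman (s i) (s j).
Proof.
apply: contrapT => nex.
have /minimal_bad_sequence[m [m_bad m_min]] : bad_sequence s.
  by move=> i j ij h; apply: nex; exists i, j.
have mE n : m n = head 0 (m n) :: behead (m n).
  have := m_bad n n.+1 (ltnSn n); case: (m n) => //= h.
  by case: h; apply: higman_nil.
have [f [f_mono f_le]] := nat_monotone_subsequence (fun n => head 0 (m n)).
pose t n := if n < f 0 then m n else behead (m (f (n - f 0))).
have f_ge n : f 0 <= f n by case: n => // n; apply/ltnW/f_mono.
have t_bad : bad_sequence t.
  move=> i j ij; rewrite /t; case: (ltnP i (f 0)) => i0.
    case: ltnP => j0; first exact: m_bad.
    (* An embedding into a tail is one into the whole word; below, an embedding between two tails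
       extends to the words because the heads are ordered. *)
    move=> h; apply: (m_bad i (f (j - f 0))); first exact: leq_trans i0 _.
    by rewrite (mE (f _)); apply: higman_drop.
  have j0 := leq_trans i0 (ltnW ij); rewrite ltnNge j0 /= => h.
  have kl : i - f 0 < j - f 0 by rewrite ltn_sub2r // (leq_ltn_trans i0 ij).
  apply: (m_bad _ _ (f_mono _ _ kl)).
  by rewrite (mE (f (i - _))) (mE (f (j - _))); apply: higman_cons => //;
    apply: f_le; apply: ltnW.
have t_m i : i < f 0 -> t i = m i by rewrite /t => ->.
by have := m_min (f 0) t t_bad t_m; rewrite /t ltnn subnn mE /= ltnn.
Qed.

(** This is the form applied to codes, whose first entry is compared separately from the rest. *)
Lemma higman_pair_good (a : nat -> nat) (s : nat -> seq nat) :
  exists i j, [/\ i < j, a i <= a j & higman (s i) (s j)].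
Proof.
have [f [f_mono f_le]] := nat_monotone_subsequence a.
have [i [j [ij h]]] := higman_good (s \o f).
by exists (f i), (f j); split=> //; [apply: f_mono | apply: f_le; apply: ltnW].
Qed.

(* In a code, [n :: l] stands for n four-element blocks, then a two-element one,
   then the blocks coded by l, from bottom to top. *)
Inductive block_emb : seq nat -> seq nat -> Prop :=
| block_emb_nil : block_emb [::] [::]
| block_emb_cons u v : block_emb u v -> block_emb (0 :: u) (0 :: v)
| block_emb_drop u v : block_emb (0 :: u) v -> block_emb (0 :: u) (0 :: v)
| block_emb_drop1 u b v : block_emb (0 :: u) (b :: v) ->
    block_emb (0 :: u) (b.+1 :: v)
| block_emb_succ a u b v : block_emb (a :: u) (b :: v) ->
    block_emb (a.+1 :: u) (b.+1 :: v).

(** A two-element block at the bottom of the source can be stretched over any Boolean blocks added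
    below the target. *)
Lemma block_emb_absorb u b v :
  block_emb (0 :: u) (0 :: v) -> block_emb (0 :: u) (b :: v).
Proof. by move=> h; elim: b => // b; apply: block_emb_drop1. Qed.

(** The [a] bottom Boolean blocks are matched one to one; the hypothesis is then used with the
    [b - a] blocks left over in the target. *)
Lemma block_emb_add a u b v : a <= b ->
  (forall c, block_emb (0 :: u) (c :: v)) -> block_emb (a :: u) (b :: v).
Proof.
move=> ab h; elim: a b ab => [|a IHa] [|b] // ab.
by apply: block_emb_succ; apply: IHa.
Qed.

(** The two previous lemmas reduce both first entries to 0. The two-element block then at the bottom
    of the source is stretched over each dropped entry, and is matched with a single block when the
    next two entries are compared. *)
Lemma higman_block_emb a b u v : a <= b -> higman u v ->
  block_emb (a :: u) (b :: v).
Proof.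
move=> ab h; apply: block_emb_add ab _ => c; apply: block_emb_absorb.
elim: h => {a b c u v}.
- elim=> [|b v IHv]; first exact/block_emb_cons/block_emb_nil.
  exact/block_emb_drop/block_emb_absorb.
- by move=> b u v _ IH; apply/block_emb_drop/block_emb_absorb.
- move=> a b u v ab _ IH; apply: block_emb_cons.
  by apply: block_emb_add => // c; apply: block_emb_absorb.
Qed.

End Higman.

(** * Decomposition of the algebra into blocks *)

(** Induction on the number of predecessors: those of [y], together with [y] itself, are
    predecessors of [x], and [y] does not precede itself. *)
Lemma finite_rel_ind (T : eqType) (r : rel T) (P : T -> Prop) :
  (exists s : seq T, forall x, x \in s) -> irreflexive r -> transitive r ->
  (forall x, (forall y, r y x -> P y) -> P x) -> forall x, P x.
Proof.
move=> [s sT] r_irr r_tr IH x.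
have [n] := ubnP (count (r^~ x) s); elim: n x => // n IHn x hn.
apply: IH => y yx; apply: IHn; rewrite ltnS in hn; apply: leq_trans hn.
have := count_predUI (r^~ y) (pred1 y) s.
rewrite [count (predI _ _) s](@eq_count _ _ pred0) => [|z /=]; last first.
  by case: eqP => [->|]; rewrite ?r_irr ?andbF.
rewrite count_pred0 addn0 => hU.
have : (count (predU (r^~ y) (pred1 y)) s <= count (r^~ x) s)%N.
  by apply: sub_count => z /= /orP[/r_tr|/eqP->//]; apply.
apply: leq_trans; rewrite hU -addn1 leq_add2l -has_count.
by apply/hasP; exists y => /=.
Qed.

Section Shape.
Context {d : Order.disp_t} {A : heytingType d}.
Hypothesis finA : exists s : seq A, forall x, x \in s.
Implicit Types a b c j k p q u x y : A.

Lemma finite_lt_ind (P : A -> Prop) :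
  (forall x, (forall y, y < x -> P y) -> P x) -> forall x, P x.
Proof. exact: (finite_rel_ind finA (@ltxx _ A) (@lt_trans _ A)). Qed.

Lemma finite_gt_ind (P : A -> Prop) :
  (forall x, (forall y, x < y -> P y) -> P x) -> forall x, P x.
Proof.
apply: (@finite_rel_ind _ (fun y x => x < y) _ finA) => [x|y x z xy yz].
  exact: ltxx.
exact: lt_trans yz xy.
Qed.

Lemma exists_minimal (P : A -> Prop) x : P x ->
  exists2 m, P m & forall y, y < m -> ~ P y.
Proof.
move: x; apply: finite_lt_ind => x IH Px.
have [[y [yx Py]]|nex] := pselect (exists y, y < x /\ P y).
  exact: IH yx Py.
by exists x => // y yx Py; apply: nex; exists y.
Qed.

Definition single c p := c < p /\ forall x, c <= x -> x = c \/ p <= x.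

Definition diamond c p q :=
  [/\ c < p, c < q, Order.meet p q = c & forall x, c <= x ->
      [\/ x = c, x = p, x = q | Order.join p q <= x]].

(** The code describes the elements above [c]. A diamond is only placed under a nonempty code, so
    the topmost block is always a two-element one. *)
Inductive shape : A -> seq nat -> Prop :=
| shape_nil : shape \top [::]
| shape_single c p l : single c p -> shape p l -> shape c (0%N :: l)
| shape_diamond c p q n l : diamond c p q ->
    shape (Order.join p q) (n :: l) -> shape c (n.+1 :: l).

Hypothesis coverA : forall a b, ~~ (a <= b) -> ~~ (b <= a) ->
  exists2 j, Order.join a b < j & forall x, x < j -> x <= Order.join a b.

(* In a counterexample (a, b, c) with c minimal, take j from [coverA] for a, b and
   k for c, a \/ b: then (j, c, k) is a counterexample with a larger join. *)
Lemma join_comparable a b c : ~~ (a <= b) -> ~~ (b <= a) ->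
  c <= Order.join a b \/ Order.join a b <= c.
Proof.
move En: (Order.join a b) => u; move: u a b c En.
apply: finite_gt_ind => u IH a b c0 Eu nab nba.
apply: contrapT => /not_orP[/negP nc0u /negP nuc0].
have [c [ncu nuc] cmin] : exists2 c, ~~ (c <= u) /\ ~~ (u <= c) &
    forall x, x < c -> x <= u.
  have [] := @exists_minimal (fun c => ~~ (c <= u) /\ ~~ (u <= c)) c0 => //.
  move=> c [ncu nuc] cmin; exists c => // x xc.
  apply: contraT => nxu; case: (cmin _ xc); split=> //.
  by apply: contraNN nuc => ux; apply: le_trans ux (ltW xc).
have [j uj jmin] := coverA nab nba; rewrite Eu in uj jmin.
have [k uck kmin] := coverA ncu nuc.
have ck : c < k by apply: le_lt_trans uck; rewrite leUl.
have njc : ~~ (j <= c).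
  by apply: contraNN nuc => jc; apply: le_trans (ltW uj) jc.
have ncj : ~~ (c <= j).
  by rewrite le_eqVlt negb_or (contraNneq _ njc) => [|->//];
    apply: contraNN ncu => /jmin.
have njk : ~~ (j <= k).
  rewrite le_eqVlt negb_or; apply/andP; split.
    by apply: contraNneq ncj => ->; apply: ltW.
  (* By distributivity [j] is the join of its meets with [c] and [u]. Both are at most [u], the
     first because it is strictly below [j], so [j <= u], a contradiction. *)
  apply/negP => /kmin juc.
  have cj : Order.meet j c < j by rewrite lt_neqAle leIl andbT eq_meetl.
  have : j <= u.
    have /meet_idPl <- := juc; rewrite meetUr leUx (jmin _ cj) /=.
    by rewrite leIr.
  by move=> /(lt_le_trans uj); rewrite ltxx.
have kj : Order.meet k j < j by rewrite lt_neqAle leIr andbT eq_meetr.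
have [] := IH (Order.join j c) _ j c k erefl njc ncj.
- by apply: lt_le_trans uj _; rewrite leUl.
- move=> kjc; have : k <= Order.join c u.
    have /meet_idPl <- := kjc; rewrite meetUr leUx.
    by rewrite lexU2 ?(jmin _ kj) ?orbT //= lexU2 // leIr.
  by move=> /(lt_le_trans uck); rewrite ltxx.
- by rewrite leUx (negbTE njk).
Qed.

Lemma exists_cover c x : c < x ->
  exists p, [/\ c < p, p <= x & forall y, c <= y -> y <= p -> y = c \/ y = p].
Proof.
move=> cx; have [|p [cp px] pmin] := @exists_minimal
  (fun p => c < p /\ p <= x) x; first by [].
exists p; split=> // y; rewrite !le_eqVlt => /predU1P[->|cy]; first by left.
case/predU1P => [->|yp]; first by right.
by case: (pmin _ yp); split=> //; apply: le_trans (ltW yp) px.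
Qed.

(** Let [p] cover [c]. If some [x] strictly above [c] is not above [p], a cover [q] of [c] below [x]
    is incomparable with [p], and [join_comparable] leaves only elements below or above their join.
    That join is not [\top], since [coverA] gives an element above it. *)
Lemma single_or_diamond c : c < \top ->
  (exists p, single c p) \/ exists p q, diamond c p q /\ Order.join p q < \top.
Proof.
move=> c1; have [p [cp _ pmin]] := exists_cover c1.
have [h|/existsNP[x /not_implyP[cx /not_orP[/eqP xc /negP npx]]]] :=
  pselect (forall x, c <= x -> x = c \/ p <= x).
  by left; exists p.
have {cx xc} cx : c < x by rewrite lt_neqAle eq_sym xc.
have [q [cq qx qmin]] := exists_cover cx.
have npq : ~~ (p <= q) by apply: contraNN npx => /le_trans; apply.
have nqp : ~~ (q <= p).
  apply/negP => /(pmin _ (ltW cq))[qc|qp]; first by rewrite qc ltxx in cq.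
  by rewrite qp lexx in npq.
right; exists p, q; split; last first.
  by have [j /lt_le_trans jlt _] := coverA npq nqp; apply: jlt; apply: lex1.
split=> //.
  have [||//|pqp] := pmin (Order.meet p q); rewrite ?leIl ?lexI ?ltW //.
  by rewrite -pqp leIr in npq.
move=> y cy; have [yt|ty] := join_comparable y npq nqp; last exact: Or44.
(* As [p] and [q] cover [c], each of these meets has only two possible values. *)
have yE : y = Order.join (Order.meet y p) (Order.meet y q).
  by rewrite -meetUr; apply/esym/meet_idPl.
have [||yp|yp] := pmin (Order.meet y p); rewrite ?leIr ?lexI ?cy ?(ltW cp) //;
  have [||yq|yq] := qmin (Order.meet y q); rewrite ?leIr ?lexI ?cy ?(ltW cq) //;
  rewrite yE yp yq.
- by apply: Or41; rewrite joinxx.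
- by apply: Or43; apply: join_r; apply: ltW.
- by apply: Or42; apply: join_l; apply: ltW.
- exact: Or44.
Qed.

Lemma exists_shape c : exists l, shape c l.
Proof.
move: c; apply: finite_gt_ind => c IH.
have := lex1 c; rewrite le_eqVlt => /predU1P[->|/single_or_diamond].
  by exists [::]; apply: shape_nil.
case=> [[p cp]|[p [q [cpq t1]]]].
  have [l pl] := IH _ cp.1; exists (0%N :: l); exact: shape_single pl.
have cpt : c < Order.join p q.
  by case: cpq => cp _ _ _; apply: lt_le_trans cp _; rewrite leUl.
have [[|n l] tl] := IH _ cpt.
  by inversion tl as [e| |]; rewrite -e ltxx in t1.
exists (n.+1 :: l); exact: shape_diamond tl.
Qed.

End Shape.

(** * Implications within and onto a bottom block *)

Section HimpValues.
Context {d : Order.disp_t} {A : heytingType d}.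
Implicit Types c p q x y : A.

Lemma himp_ge x y : y <= himp x y.
Proof. by rewrite le_himp leIl. Qed.

Lemma himp_mp x y z : z <= x -> z <= himp x y -> z <= y.
Proof. by move=> /meet_l zx; rewrite le_himp zx. Qed.

Lemma single_himp c p x : single c p -> p <= x -> himp x c = c.
Proof.
move=> [cp cE] px; have [//|/(himp_mp px) pc] := cE _ (himp_ge x c).
by have := lt_le_trans cp pc; rewrite ltxx.
Qed.

Lemma diamond_sym c p q : diamond c p q -> diamond c q p.
Proof.
case=> cp cq pq cE; split; rewrite // 1?meetC // => x /cE.
by rewrite joinC; case=> [->|->|->|?];
  [apply: Or41|apply: Or43|apply: Or42|apply: Or44].
Qed.

Lemma diamond_nle c p q : diamond c p q -> ~~ (p <= q).
Proof.
case=> cp _ pq _; apply/negP => /meet_l; rewrite pq => e.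
by rewrite e ltxx in cp.
Qed.

(** An implication is above its conclusion, hence above [c], so the definition of a diamond leaves
    four possibilities; modus ponens excludes all but one. The next two lemmas follow the same
    pattern. *)
Lemma diamond_himp_top_bot c p q x : diamond c p q ->
  Order.join p q <= x -> himp x c = c.
Proof.
move=> D tx; have := tx; rewrite leUx => /andP[px qx].
have [cp cq _ cE] := D.
have npc : ~~ (p <= himp x c).
  by apply/negP => /(himp_mp px) /(lt_le_trans cp); rewrite ltxx.
have nqc : ~~ (q <= himp x c).
  by apply/negP => /(himp_mp qx) /(lt_le_trans cq); rewrite ltxx.
have [//|e|e|] := cE _ (himp_ge x c).
- by rewrite e lexx in npc.
- by rewrite e lexx in nqc.
- by rewrite leUx (negbTE npc).
Qed.

Lemma diamond_himp_top_side c p q x : diamond c p q ->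
  Order.join p q <= x -> himp x p = p.
Proof.
move=> D tx; have := tx; rewrite leUx => /andP[px qx].
have [cp _ _ cE] := D.
have nqp : ~~ (q <= himp x p).
  by apply/negP => /(himp_mp qx); apply/negP/(diamond_nle (diamond_sym D)).
have [e|//|e|] := cE _ (le_trans (ltW cp) (himp_ge x p)).
- by have := himp_ge x p; rewrite e => /(lt_le_trans cp); rewrite ltxx.
- by rewrite e lexx in nqp.
- by rewrite leUx (negbTE nqp) andbF.
Qed.

Lemma diamond_himp_side_bot c p q : diamond c p q -> himp p c = q.
Proof.
move=> D; have [cp cq pq cE] := D.
have qpc : q <= himp p c by rewrite le_himp meetC pq.
have npc : ~~ (p <= himp p c).
  by apply/negP => /(himp_mp (lexx p)) /(lt_le_trans cp); rewrite ltxx.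
have [e|e|//|] := cE _ (himp_ge p c).
- by have := lt_le_trans cq qpc; rewrite e ltxx.
- by rewrite e lexx in npc.
- by rewrite leUx (negbTE npc).
Qed.

Lemma diamond_himp_sides c p q : diamond c p q -> himp p q = q.
Proof.
move=> D; apply/eqP; rewrite eq_le himp_ge andbT.
rewrite -[leRHS](diamond_himp_side_bot D) le_himp.
by case: D => _ _ <- _; rewrite lexI leIr -le_himp lexx.
Qed.

End HimpValues.

(** * Embeddings built from the top downwards *)

Section UpperEmbedding.
Context {d : Order.disp_t} {A B : heytingType d}.
Implicit Types (a c p q x y : A) (b e : B).

(** An embedding of the elements above [c] into those above [b]; values of [f] elsewhere are
    arbitrary. Injectivity is expressed by a trivial kernel, which is easier to carry through the
    extensions. *)
Record upper_emb c b (f : A -> B) : Prop := UpperEmb {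
  upper_emb_base : f c = b;
  upper_embI : forall x y, c <= x -> c <= y ->
    f (Order.meet x y) = Order.meet (f x) (f y);
  upper_embU : forall x y, c <= x -> c <= y ->
    f (Order.join x y) = Order.join (f x) (f y);
  upper_emb_himp : forall x y, c <= x -> c <= y ->
    f (himp x y) = himp (f x) (f y);
  upper_emb_ker : forall x, c <= x -> f x = \top -> x = \top
}.

Lemma upper_emb_homo c b f x y : upper_emb c b f ->
  c <= x -> x <= y -> f x <= f y.
Proof.
move=> F cx xy; have cy := le_trans cx xy.
by have := upper_embI F cx cy; rewrite (meet_l xy) => ->; apply: leIr.
Qed.

Lemma upper_emb_ge c b f x : upper_emb c b f -> c <= x -> b <= f x.
Proof.
by move=> F cx; rewrite -(upper_emb_base F); apply: (upper_emb_homo F).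
Qed.

Lemma upper_emb_top c b f : upper_emb c b f -> f \top = \top.
Proof.
move=> F.
by rewrite -(himp_le1 (lexx c)) (upper_emb_himp F) ?lexx // himp_le1.
Qed.

(** Equal images send both implications to [\top], so the kernel condition gives both
    inequalities. *)
Lemma upper_emb_inj c b f x y : upper_emb c b f ->
  c <= x -> c <= y -> f x = f y -> x = y.
Proof.
move=> F; suff le_f u v : c <= u -> c <= v -> f u = f v -> u <= v.
  by move=> cx cy fxy; apply/le_anti/andP; split; apply: le_f.
move=> cu cv fuv; have : himp u v = \top.
  apply: (upper_emb_ker F); first exact: le_trans cv (himp_ge u v).
  by rewrite (upper_emb_himp F) // fuv himp_le1.
by move=> uv; rewrite -[u]meet1x -le_himp uv.
Qed.

Lemma upper_emb_restrict c b f p : upper_emb c b f -> c <= p ->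
  upper_emb p (f p) f.
Proof.
case=> fc fI fU fH fK cp; have up x : p <= x -> c <= x by apply: le_trans.
by split=> // [x y ? ?|x y ? ?|x y ? ?|x ?];
  [apply: fI|apply: fU|apply: fH|apply: fK]; apply: up.
Qed.

Lemma upper_emb_const : upper_emb \top \top (fun=> \top).
Proof.
split=> // [x y _ _|x y _ _|x y _ _|x x1 _].
- by rewrite meetxx.
- by rewrite joinxx.
- by rewrite himp_le1.
- by apply/eqP; rewrite -le1x.
Qed.

Lemma homo_meetU (f : A -> B) x y : x <= y -> f x <= f y ->
  f (Order.meet x y) = Order.meet (f x) (f y) /\
  f (Order.join x y) = Order.join (f x) (f y).
Proof. by move=> xy fxy; rewrite (meet_l xy) (meet_l fxy) !join_r. Qed.

(** The extension sends [c] to [b] and agrees with [f] from [p] on. It is not assumed that [e]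
    covers [b], only that implications into [b] collapse; this lets a two-element block stretch over
    several blocks. *)
Lemma upper_emb_single c p b e f : single c p -> upper_emb p e f ->
  b < e -> (forall z, e <= z -> himp z b = b) ->
  exists g, upper_emb c b g.
Proof.
move=> S F be bH; have [cp cE] := S.
have f_ge x : p <= x -> e <= f x by apply: upper_emb_ge F.
pose g x := if x == c then b else f x.
have gc : g c = b by rewrite /g eqxx.
have gp x : p <= x -> g x = f x.
  by move=> px; rewrite /g gt_eqF // (lt_le_trans cp).
have gcx x : c <= x -> b <= g x.
  move=> /cE[->|px]; first by rewrite gc.
  by rewrite gp // (le_trans (ltW be)) ?f_ge.
have gIU x y : c <= x -> c <= y ->
    g (Order.meet x y) = Order.meet (g x) (g y) /\
    g (Order.join x y) = Order.join (g x) (g y).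
  move=> /[dup] cx /cE[->|px] /[dup] cy /cE[->|py].
  - exact: homo_meetU.
  - by apply: homo_meetU; rewrite // gc gcx.
  - rewrite meetC joinC [RHS in _ = RHS /\ _]meetC [RHS in _ /\ _ = RHS]joinC.
    by apply: homo_meetU; rewrite // gc gcx.
  - rewrite !gp ?lexI ?px ?py ?lexU2 ?px //.
    by rewrite (upper_embI F) // (upper_embU F).
exists g; split=> //.
- by move=> x y cx cy; case: (gIU x y cx cy).
- by move=> x y cx cy; case: (gIU x y cx cy).
- move=> x y /[dup] cx /cE[->|px] cy.
    by rewrite !himp_le1 ?gc ?gcx // gp ?lex1 // (upper_emb_top F).
  have [->|py] := cE y cy.
    by rewrite (single_himp S) // gc gp // bH // f_ge.
  by rewrite !gp ?(upper_emb_himp F) // (le_trans py) // himp_ge.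
- move=> x /cE[->|px]; last by rewrite gp //; apply: (upper_emb_ker F).
  by rewrite gc => b1; have := lt_le_trans be (lex1 e); rewrite b1 ltxx.
Qed.


(** The extension sends [c], [p], [q] to [b], [p'], [q']; the implications involving these are the
    same on both sides by the computations for diamonds. *)
Lemma upper_emb_diamond c p q b (p' q' : B) f :
  diamond c p q -> diamond b p' q' ->
  upper_emb (Order.join p q) (Order.join p' q') f ->
  exists g, upper_emb c b g.
Proof.
move=> D D' F; have [cp cq pq cE] := D; have [bp' bq' pq' _] := D'.
set t := Order.join p q in F cE *; set t' := Order.join p' q' in F.
have pt : p <= t by rewrite leUl.
have qt : q <= t by rewrite leUr.
have ct : c < t by apply: lt_le_trans cp pt.
have ft : f t = t' := upper_emb_base F.
have f_ge x : t <= x -> t' <= f x by apply: upper_emb_ge F.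
have f_gep x : t <= x -> p' <= f x.
  by move=> /f_ge; apply: le_trans; rewrite leUl.
have f_geq x : t <= x -> q' <= f x.
  by move=> /f_ge; apply: le_trans; rewrite leUr.
pose g x := if x == c then b else if x == p then p' else
  if x == q then q' else f x.
have gc : g c = b by rewrite /g eqxx.
have gp : g p = p' by rewrite /g gt_eqF // eqxx.
have gq : g q = q'.
  rewrite /g gt_eqF // eqxx ifF //; apply/negP => /eqP e.
  by have := diamond_nle D; rewrite e lexx.
have gT x : t <= x -> g x = f x.
  move=> tx; rewrite /g gt_eqF ?(lt_le_trans ct) // !ifF //.
    apply/negP => /eqP e; have := diamond_nle D.
    by rewrite -e (le_trans pt).
  apply/negP => /eqP e; have := diamond_nle (diamond_sym D).
  by rewrite -e (le_trans qt).
have gcx x : c <= x -> b <= g x.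
  case/cE=> [->|->|->|tx]; rewrite ?gc ?gp ?gq ?(ltW bp') ?(ltW bq') //.
  by rewrite gT // (le_trans (ltW bp')) ?f_gep.
pose K x y := g (Order.meet x y) = Order.meet (g x) (g y) /\
  g (Order.join x y) = Order.join (g x) (g y).
(* Symmetry cuts down the sixteen pairs of positions to be checked. *)
have K_sym x y : K x y -> K y x.
  by rewrite /K meetC joinC [Order.meet (g y) _]meetC [Order.join (g y) _]joinC.
have Kc x : c <= x -> K c x by move=> cx; apply: homo_meetU; rewrite // gc gcx.
have Kp x : t <= x -> K p x.
  by move=> tx; apply: homo_meetU; rewrite ?(le_trans pt) // gp gT ?f_gep.
have Kq x : t <= x -> K q x.
  by move=> tx; apply: homo_meetU; rewrite ?(le_trans qt) // gq gT ?f_geq.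
have c_p := ltW cp; have c_q := ltW cq.
have Kpq : K p q by rewrite /K pq gc gp gq pq' -/t gT.
have Kxx x : K x x by rewrite /K meetxx joinxx meetxx joinxx.
have gIU x y : c <= x -> c <= y -> K x y.
  move=> /[dup] cx /cE[->|->|->|tx] /[dup] cy /cE[->|->|->|ty] //;
    do ?[exact: Kxx|exact: Kc|exact: Kp|exact: Kq|exact: Kpq
        |by apply: K_sym; do ?[exact: Kc|exact: Kp|exact: Kq|exact: Kpq]].
  have tI : t <= Order.meet x y by rewrite lexI tx.
  have tU : t <= Order.join x y by rewrite lexU2 ?tx.
  by rewrite /K !gT // (upper_embI F) // (upper_embU F).
have g1 : g \top = \top by rewrite gT ?lex1 ?(upper_emb_top F).
have gH_le x y : x <= y -> g x <= g y -> g (himp x y) = himp (g x) (g y).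
  by move=> xy gxy; rewrite !himp_le1.
have Dsym := diamond_sym D; have D'sym := diamond_sym D'.
have tC : Order.join q p = t by rewrite joinC.
have tC' : Order.join q' p' = t' by rewrite joinC.
exists g; split=> //.
- by move=> x y cx cy; case: (gIU x y cx cy).
- by move=> x y cx cy; case: (gIU x y cx cy).
- move=> x y /[dup] cx /cE[->|->|->|tx] /[dup] cy /cE[->|->|->|ty];
    do ?[by apply: gH_le; rewrite // ?gc ?gcx].
  + by rewrite (diamond_himp_side_bot D) gc gp gq (diamond_himp_side_bot D').
  + by rewrite (diamond_himp_sides D) gp gq (diamond_himp_sides D').
  + by apply: gH_le; rewrite ?(le_trans pt) // gp gT ?f_gep.
  + rewrite (diamond_himp_side_bot Dsym) gc gp gq.
    by rewrite (diamond_himp_side_bot D'sym).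
  + by rewrite (diamond_himp_sides Dsym) gp gq (diamond_himp_sides D'sym).
  + by apply: gH_le; rewrite ?(le_trans qt) // gq gT ?f_geq.
  + rewrite (diamond_himp_top_bot D) // gc.
    by rewrite (diamond_himp_top_bot D') ?gT ?f_ge.
  + rewrite (diamond_himp_top_side D) // gp.
    by rewrite (diamond_himp_top_side D') ?gT ?f_ge.
  + rewrite (diamond_himp_top_side Dsym) ?tC // gq.
    by rewrite (diamond_himp_top_side D'sym) ?tC' ?gT ?f_ge.
  + by rewrite !gT ?(upper_emb_himp F) // (le_trans ty) // himp_ge.
- move=> x /cE[->|->|->|tx].
  + by rewrite gc => b1; have := lt_le_trans bp' (lex1 p'); rewrite b1 ltxx.
  + by rewrite gp => e; have := diamond_nle D'sym; rewrite e lex1.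
  + by rewrite gq => e; have := diamond_nle D'; rewrite e lex1.
  + by rewrite gT //; apply: (upper_emb_ker F).
Qed.

End UpperEmbedding.

(** * From codes to embeddings of algebras *)

Lemma shape_nilE d (A : heytingType d) (c : A) : shape c [::] -> c = \top.
Proof. by move=> S; inversion S. Qed.

Lemma shape0E d (A : heytingType d) (c : A) l : shape c (0%N :: l) ->
  exists2 p, single c p & shape p l.
Proof. by move=> S; inversion S as [|? p|]; exists p. Qed.

Lemma shapeSE d (A : heytingType d) (c : A) n l : shape c (n.+1 :: l) ->
  exists p q, diamond c p q /\ shape (Order.join p q) (n :: l).
Proof. by move=> S; inversion S as [| |? p q]; exists p, q. Qed.

Lemma shape_upper_emb d (A B : heytingType d) (c : A) (b : B) u v :
  block_emb u v -> shape c u -> shape b v -> exists f, upper_emb c b f.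
Proof.
move=> uv; elim: uv c b => {u v}.
- move=> c b /shape_nilE -> /shape_nilE ->.
  by exists (fun=> \top); apply: upper_emb_const.
- move=> u v _ IH c b /shape0E[p cp pu] /shape0E[e be ev].
  have [f F] := IH _ _ pu ev.
  by apply: upper_emb_single cp F be.1 _ => z; apply: single_himp.
(* Here [f] already embeds everything above [c] above [e]. Its value at [c] is discarded by
   restricting to [p], and [c] is sent down to [b]; the next case does this across a Boolean
   block. *)
- move=> u v _ IH c b cu /shape0E[e be ev].
  have [f F] := IH _ _ cu ev.
  have [p cp _] := shape0E cu; have c_p := ltW cp.1.
  have ep := upper_emb_ge F c_p.
  apply: (upper_emb_single cp (upper_emb_restrict F c_p)).
    exact: lt_le_trans be.1 ep.
  by move=> z /(le_trans ep); apply: single_himp.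
- move=> u n v _ IH c b cu /shapeSE[p' [q' [D ev]]].
  have [f F] := IH _ _ cu ev.
  have [p cp _] := shape0E cu; have c_p := ltW cp.1.
  have ep := upper_emb_ge F c_p; have [bp' _ _ _] := D.
  apply: (upper_emb_single cp (upper_emb_restrict F c_p)).
    by apply: lt_le_trans ep; apply: lt_le_trans bp' _; rewrite leUl.
  by move=> z /(le_trans ep); apply: diamond_himp_top_bot.
- move=> n u m v _ IH c b /shapeSE[p [q [D pu]]] /shapeSE[p' [q' [D' pv]]].
  have [f F] := IH _ _ pu pv; exact: upper_emb_diamond D D' F.
Qed.

(** * The embeddability order and its well quasi-ordering *)

Lemma heyting_embedsP d (A B : heytingType d) :
  heyting_embeds A B <->
  exists f : A -> B, heyting_morphism f /\ injective f.
Proof.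
split=> [[S [_ [f [fM [_ fI _]]]]]|[f [fM fI]]].
  by exists f; split=> // x y; apply: fI; rewrite in_setE.
exists (range f); split; last first.
  by exists f; split=> //; split=> // x y _ _; apply: fI.
case: fM => gI gU gH gN; split; first by exists (f \bot), \bot.
split=> [_ _ [x _ <-] [y _ <-]|_ _ [x _ <-] [y _ <-]
  |_ _ [x _ <-] [y _ <-]|_ [x _ <-]].
- by exists (Order.meet x y).
- by exists (Order.join x y).
- by exists (himp x y).
- by exists (hneg x).
Qed.

Lemma heyting_embeds_refl d (A : heytingType d) : heyting_embeds A A.
Proof. by apply/heyting_embedsP; exists id; split=> [|x y]. Qed.

Lemma heyting_embeds_trans d (A B C : heytingType d) :
  heyting_embeds A B -> heyting_embeds B C -> heyting_embeds A C.
Proof.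
move=> /heyting_embedsP[f [[fI fU fH fN] f_inj]].
move=> /heyting_embedsP[g [[gI gU gH gN] g_inj]].
apply/heyting_embedsP; exists (g \o f); split; last exact: inj_comp.
by split=> [x y|x y|x y|x] /=;
  rewrite (fI, fU, fH, fN) (gI, gU, gH, gN).
Qed.

Lemma upper_emb_bot_embeds d (A B : heytingType d) (f : A -> B) :
  upper_emb \bot \bot f -> heyting_embeds A B.
Proof.
move=> F; apply/heyting_embedsP; exists f; split; last first.
  by move=> x y; apply: (upper_emb_inj F); apply: le0x.
have fH x y : f (himp x y) = himp (f x) (f y).
  by apply: (upper_emb_himp F); apply: le0x.
split=> [x y|x y|//|x].
- by apply: (upper_embI F); apply: le0x.
- by apply: (upper_embU F); apply: le0x.
- by rewrite /hneg fH (upper_emb_base F).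
Qed.

Lemma finite_projective_shape d (A : heytingType d) :
  finite_projective_heyting d A -> exists n l, shape (\bot : A) (n :: l).
Proof.
case=> /finite_seqP[s sE] projA.
have finA : exists s : seq A, forall x, x \in s.
  by exists s => x; have : [set: A]%classic x by []; rewrite sE.
have [[|n l] S] := exists_shape finA (projective_cover finA projA) \bot.
  (* An empty code would mean that [\bot] is [\top], but [e] takes different values there. *)
  have [e [_ _ _ _ [e1 /negP[]]]] := projective_point projA (\bot : A).
  by rewrite (shape_nilE S).
by exists n, l.
Qed.

Lemma finite_projective_good d (s : nat -> heytingType d) :
  (forall n, finite_projective_heyting d (s n)) ->
  exists i j, (i < j)%N /\ heyting_embeds (s i) (s j).
Proof.
move=> sP.
have /choice[a /choice[l al]] n := finite_projective_shape (sP n).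
have [i [j [ij aij lij]]] := higman_pair_good a l.
exists i, j; split=> //.
have [f F] := shape_upper_emb (higman_block_emb aij lij) (al i) (al j).
exact: upper_emb_bot_embeds F.
Qed.

Theorem theorem11 (d : Order.disp_t) :
  well_quasi_ordered (finite_projective_heyting d) (@heyting_embeds d).
Proof.
split.
- split=> [x _|x y z _ _ _]; first exact: heyting_embeds_refl.
  exact: heyting_embeds_trans.
- move=> [s [sP s_dec]].
  have [i [j [ij e]]] := finite_projective_good sP.
  (* The sequence descends, so [s j] embeds in [s i.+1]; with [s i] embedding in [s j], this
     contradicts the strictness of the step from [i] to [i.+1]. *)
  have s_le k : heyting_embeds (s (i.+1 + k)%N) (s i.+1).
    elim: k => [|k IHk]; first by rewrite addn0; apply: heyting_embeds_refl.
    by rewrite addnS; apply: heyting_embeds_trans (s_dec _).1 IHk.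
  apply: (s_dec i).2; apply: heyting_embeds_trans e _.
  by rewrite -(subnKC ij).
- move=> [S [SP /infiniteP/card_leP[f] S_anti]].
  (* An infinite antichain contains an injective sequence, to which the same result applies. *)
  pose g (n : nat) : heytingType d := val (f (SigSub (in_setT n))).
  have gS n : S (g n) by apply/set_mem/valP.
  have [i [j [ij e]]] := finite_projective_good (fun n => SP _ (gS n)).
  have gij : g i <> g j.
    move=> /val_inj/(@inj _ _ _ f); rewrite !in_setT => /(_ isT isT) [] ijE.
    by rewrite ijE ltnn in ij.
  by have [] := S_anti _ _ (gS i) (gS j) gij.
Qed.
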